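(* Consider a two-user downlink system aided by an active STAR-RIS with $M\ge 1$ elements, with Rician fading channels, received SNR $\gamma^\chi$ and diversity order $d^\chi$ of user $\chi\in\{A,B\}$ as defined in the context. Then user $A$ under a coupled phase-shift STAR-RIS, and both users $\chi\in\{A,B\}$ under an independent phase-shift STAR-RIS, have diversity order $M$: $$d^{\chi}_{\text{independent}}=d^{A}_{\text{coupled}}=M\qquad(\chi\in\{A,B\}).$$
   Context: Channels: for $m=1,\dots,M$ let $g_m$ (base station to element $m$) and $h^\chi_m$ (element $m$ to user $\chi$), $\chi\in\{A,B\}$, be mutually independent complex random variables exhibiting Rician fading, $|g_m|\sim\mathcal R(K_g,\Omega_g)$ and $|h^\chi_m|\sim\mathcal R(K^\chi_h,\Omega^\chi_h)$. Here Rician fading with shape parameter $K\ge 0$ and scale parameter $\Omega>0$ means that the channel is $\sqrt{K\Omega/(K+1)}\,e^{j\theta}+w$ with $\theta$ a deterministic phase (which may depend on the link) and $w$ a circularly symmetric complex Gaussian variable of mean $0$ and variance $\mathbb E|w|^2=\Omega/(K+1)$. SNR: with transmit power $p>0$, element noise variance $\sigma_v^2>0$, user noise variance $\sigma_\chi^2>0$, and element response with phase $\phi^\chi_m$ and amplitude $G^\chi_m=G^\chi>0$ (the same for all $m$) towards user $\chi$, the received SNR is $$\gamma^\chi=\frac{p\left|\sum_{m=1}^M h^\chi_mG^\chi_me^{j\phi^\chi_m}g_m\right|^2}{\left|\sum_{m=1}^M h^\chi_mG^\chi_me^{j\phi^\chi_m}\right|^2\sigma_v^2+\sigma_\chi^2}.$$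 Phase configuration: phases are chosen with knowledge of the channels. The base station and user $A$ are on side A, and user $B$ is on side B, so user $A$ is served by the reflection coefficients and user $B$ by the transmission coefficients. In the independent phase-shift scenario, the phases for each user $\chi\in\{A,B\}$ satisfy the cophase condition $h^\chi_me^{j\phi^\chi_m}g_m=|h^\chi_m||g_m|$ for all $m$. In the coupled phase-shift scenario, the cophase condition $h^A_me^{j\phi^A_m}g_m=|h^A_m||g_m|$ for all $m$ holds for user $A$ (the phases for user $B$ are then determined by those for user $A$). Outage and diversity: for a fixed target SNR $\gamma^\chi_{\text{target}}>0$, the outage probability is $P^\chi_{out}=\Pr\{\gamma^\chi<\gamma^\chi_{\text{target}}\}$, and the diversity order is $$d^\chi=-\lim_{p\to\infty}\frac{\log P^\chi_{out}}{\log p},$$ all other parameters being fixed. Subscripts ''independent'' and ''coupled'' indicate the scenario. *)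

(* Defs.v *)
From HB Require Import structures.
From mathcomp Require Import all_boot all_order all_algebra.
From mathcomp Require Import complex.
From mathcomp Require Import all_classical all_reals all_analysis.

Set Implicit Arguments.
Unset Strict Implicit.
Unset Printing Implicit Defensive.

Import Order.TTheory GRing.Theory Num.Theory.
Import numFieldNormedType.Exports.
Import ComplexField.Normc.

Local Open Scope classical_set_scope.
Local Open Scope ring_scope.
Local Open Scope complex_scope.

Inductive user := UserA | UserB.

Definition bool_of_user (c : user) : bool := if c is UserA then true else false.
Definition user_of_bool (b : bool) : user := if b then UserA else UserB.
Lemma bool_of_userK : cancel bool_of_user user_of_bool. Proof. by case. Qed.

HB.instance Definition _ := Finite.copy user (can_type bool_of_userK).

Definition expi {R : realType} (t : R) : R[i] := cos t +i* sin t.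

(* R[i] carries no sigma-algebra in the libraries: complex random variables are
   handled through this identification with R * R (product Borel sets). *)
Definition ReIm {R : realType} (z : R[i]) : R * R :=
  (complex.Re z, complex.Im z).

(* Circularly symmetric complex Gaussian of mean 0 and variance v = E|w|^2:
   real and imaginary parts are independent N(0, v/2). The second argument of
   normal_prob is the standard deviation; it is a Gaussian law only if that
   is nonzero, so this is meant for v > 0. *)
Definition circ_complex_gaussian {R : realType} {d : measure_display}
    {T : measurableType d} (P : probability T R) (v : R) (w : T -> R[i]) : Prop :=
  measurable_fun [set: T] (ReIm \o w) /\
  forall B : set (R * R), measurable B ->
    P ((ReIm \o w) @^-1` B) =
    (normal_prob 0 (Num.sqrt (v / 2)) \x normal_prob 0 (Num.sqrt (v / 2)))%E B.

Definition rician {R : realType} {d : measure_display} {T : measurableType d}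
    (P : probability T R) (K Omega : R) (X : T -> R[i]) : Prop :=
  exists (theta : R) (w : T -> R[i]),
    circ_complex_gaussian P (Omega / (K + 1)) w /\
    forall t, X t = (Num.sqrt (K * Omega / (K + 1)))%:C * expi theta + w t.

Definition mutually_independent {R : realType} {d d' : measure_display}
    {T : measurableType d} {T' : measurableType d'} (P : probability T R)
    (I : finType) (X : I -> T -> T') : Prop :=
  forall (J : {set I}) (B : I -> set T'),
    (forall i, i \in J -> measurable (B i)) ->
    P (\bigcap_(i in [set` J]) (X i @^-1` B i)) =
    (\prod_(i in J) P (X i @^-1` B i))%E.

(* All 3M channels as one family: inl m is g_m, inr (c, m) is h^c_m. *)
Definition channels {R : realType} {T : Type} {M : nat} (g : 'I_M -> T -> R[i])
    (h : user -> 'I_M -> T -> R[i]) (l : 'I_M + user * 'I_M) : T -> R[i] :=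
  match l with inl m => g m | inr (c, m) => h c m end.

(* Channels g, h and phases phi are those of a fixed user; G is the common
   amplitude, sv2 and su2 are the element and user noise variances. *)
Definition snr {R : realType} {T : Type} {M : nat} (g h : 'I_M -> T -> R[i])
    (phi : 'I_M -> T -> R) (G sv2 su2 p : R) (t : T) : R :=
  p * normc (\sum_(m < M) h m t * G%:C * expi (phi m t) * g m t) ^+ 2 /
  (normc (\sum_(m < M) h m t * G%:C * expi (phi m t)) ^+ 2 * sv2 + su2).

Definition outage_probability {R : realType} {d : measure_display}
    {T : measurableType d} (P : probability T R) (gamma : T -> R)
    (target : R) : R :=
  fine (P [set t | gamma t < target]).

(* d = - lim_(p -> +oo) log Pout(p) / log p, including existence of the limit. *)
Definition has_diversity_order {R : realType} (Pout : R -> R) (d : R) : Prop :=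
  (ln (Pout p) / ln p) @[p --> +oo] --> - d.

Definition cophase {R : realType} {T : Type} {M : nat} (g h : 'I_M -> T -> R[i])
    (phi : 'I_M -> T -> R) : Prop :=
  forall m t, h m t * expi (phi m t) * g m t = `|h m t| * `|g m t|.

Definition independent_phase_shift {R : realType} {T : Type} {M : nat}
    (g : 'I_M -> T -> R[i]) (h : user -> 'I_M -> T -> R[i])
    (phi : user -> 'I_M -> T -> R) : Prop :=
  forall c, cophase g (h c) (phi c).

(* The coupling law itself is left arbitrary: the transmission phases are some
   function of the reflection phases. *)
Definition coupled_phase_shift {R : realType} {T : Type} {M : nat}
    (g : 'I_M -> T -> R[i]) (h : user -> 'I_M -> T -> R[i])
    (phi : user -> 'I_M -> T -> R) : Prop :=
  cophase g (h UserA) (phi UserA) /\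
  exists f : ('I_M -> R) -> 'I_M -> R,
    forall m t, phi UserB m t = f (fun k => phi UserA k t) m.

(* Main.v *)
(** Under the cophase condition the numerator of the SNR is
    [p (G \sum_m |h_m| |g_m|)^2], and each squared gain is governed by a Gaussian
    law on the plane, so that [P(|X|^2 <= u)] is of exact order [u] near [0] and
    [P(|X|^2 >= u)] decays exponentially.

    Lower bound: outage occurs as soon as [|h_m|^2 <= 1] and [|g_m|^2 <= r / p] for
    all [m], an event of probability at least [c p^-M] by independence.

    Upper bound: with [L] of order [ln p], some [|h_m|^2 >= L] has probability
    [O(p^-M)]; otherwise the denominator is [O(ln p)] and outage forces
    [|h_m|^2 |g_m|^2 = O(ln p / p) <= q^(n+1)] for all [m], where
    [q = p^(- n / (n+1)^2)].
    Such a product bound puts [|h_m|^2] below [q^i] and [|g_m|^2] below [q^(n-i)] for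
    some [i <= n], an event of probability [O(q^n)] whatever [i] is. Hence
    [Pout = O(p^(-M n^2 / (n+1)^2))], and [n] is arbitrary. *)

Require Import Defs.
From mathcomp Require Import all_boot all_order all_algebra.
From mathcomp Require Import complex.
From mathcomp Require Import all_classical all_reals all_analysis.
From mathcomp Require Import measurable_realfun ring lra.

Set Implicit Arguments.
Unset Strict Implicit.
Unset Printing Implicit Defensive.

Import Order.TTheory GRing.Theory Num.Theory.
Import numFieldNormedType.Exports.

Import ComplexField.Normc.

Local Open Scope classical_set_scope.
Local Open Scope ring_scope.
Local Open Scope complex_scope.

(** * Interval and tail bounds for the normal law on the line *)

Lemma measurable_EFin_normal_pdf (R : realType) (m s : R) (D : set R) :
  measurable_fun D (fun x => (normal_pdf m s x)%:E).
Proof.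
apply: (@measurableT_comp _ _ _ _ _ _ (@EFin R)) => //.
by apply: measurable_funTS; exact: measurable_normal_pdf.
Qed.

(** The density never exceeds its peak, and the interval has length [r *+ 2]. *)
Lemma normal_prob_itv_le (R : realType) (s a r : R) : s != 0 -> 0 <= r ->
  (normal_prob 0 s `[(a - r)%R, (a + r)%R] <= (normal_peak s * (r *+ 2))%R%:E)%E.
Proof.
move=> s0 r0; rewrite /normal_prob.
apply: (@le_trans _ _ (\int[lebesgue_measure]_(x in `[(a - r)%R, (a + r)%R])
    (cst (normal_peak s)%:E) x)%E).
  apply: ge0_le_integral => //=.
  - by move=> x _; rewrite lee_fin normal_pdf_ge0.
  - exact: measurable_EFin_normal_pdf.
  - by move=> x _; rewrite lee_fin normal_pdf_ub.
rewrite integral_cst//= lebesgue_measure_itv/= lte_fin.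
case: ifPn => _; last by rewrite mule0 lee_fin mulr_ge0 ?normal_peak_ge0 ?mulrn_wge0.
by rewrite -EFinB -EFinM lee_fin (_ : a + r - (a - r) = r *+ 2)//; ring.
Qed.

Lemma normal_prob_itv_ge (R : realType) (s a : R) : s != 0 ->
  exists2 c : R, 0 < c & forall r : R, 0 <= r <= 1 ->
    ((c * r)%R%:E <= normal_prob 0 s `[(a - r)%R, (a + r)%R])%E.
Proof.
move=> s0.
have s2 : 0 < s ^+ 2 *+ 2 by rewrite mulrn_wgt0// exprn_even_gt0.
(* For [r <= 1], points of the interval satisfy [(x - a) ^+ 2 <= 1], hence
   [x ^+ 2 <= (a ^+ 2 + 1) *+ 2]; so [c] is a lower bound of the density that does not depend on
   [r]. *)
pose c : R := normal_peak s * expR (- ((a ^+ 2 + 1) *+ 2) / (s ^+ 2 *+ 2)).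
have c0 : 0 < c by rewrite mulr_gt0 ?normal_peak_gt0 ?expR_gt0.
exists (c *+ 2); first by rewrite mulrn_wgt0.
move=> r /andP[r0 r1]; rewrite /normal_prob.
apply: (@le_trans _ _ (\int[lebesgue_measure]_(x in `[(a - r)%R, (a + r)%R])
    (cst c%:E) x)%E); last first.
  apply: ge0_le_integral => //=.
  - by move=> x _; rewrite lee_fin ltW.
  - exact: measurable_EFin_normal_pdf.
  - move=> x; rewrite in_itv/= => /andP[ax xa].
    rewrite lee_fin (normal_pdfE _ s0) ler_pM2l ?normal_peak_gt0//.
    rewrite ler_expR ler_pM2r ?invr_gt0// lerN2 subr0.
    have : 0 <= (1 - (x - a)) * (1 + (x - a)) by apply: mulr_ge0; lra.
    have : 0 <= (x - a *+ 2) ^+ 2 by exact: sqr_ge0.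
    nra.
rewrite integral_cst//= lebesgue_measure_itv/= lte_fin.
case: ifPn => h.
  by rewrite -EFinB -EFinM lee_fin (_ : a + r - (a - r) = r *+ 2); lra.
rewrite -leNgt in h; have r00 : r = 0 by lra.
by rewrite mule0 lee_fin r00 mulr0.
Qed.

(* On [u <= x ^ 2] half of the exponent is traded for the decay in [u]; the
   other half is the density of a normal law of twice the variance. *)
Lemma normal_prob_tail (R : realType) (s : R) : s != 0 ->
  exists2 C : R, 0 < C & forall u : R,
    (normal_prob 0 s [set x | (u <= x ^+ 2)%R] <=
     (C * expR (- u / (s ^+ 2 *+ 4)))%R%:E)%E.
Proof.
move=> s0.
pose s' := Num.sqrt 2 * s.
have s'0 : s' != 0 by rewrite mulf_neq0// gt_eqF// sqrtr_gt0.
have s'2 : s' ^+ 2 = s ^+ 2 *+ 2 by rewrite exprMn sqr_sqrtr// mulr_natl.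
have s2 : 0 < s ^+ 2 by rewrite exprn_even_gt0.
exists (normal_peak s / normal_peak s'); first by rewrite divr_gt0 ?normal_peak_gt0.
move=> u; rewrite /normal_prob.
set C : R := _ * expR _.
have C0 : 0 <= C by rewrite mulr_ge0 ?expR_ge0// divr_ge0 ?normal_peak_ge0.
have mu2 : measurable [set x : R | u <= x ^+ 2].
  rewrite -[X in measurable X]setTI.
  apply: (measurable_fun_le (f := cst u) (g := fun x : R => x ^+ 2)) => //.
apply: (@le_trans _ _ (\int[lebesgue_measure]_(x in [set x | (u <= x ^+ 2)%R])
    (C%:E * (normal_pdf 0 s' x)%:E))%E).
  apply: ge0_le_integral => //=.
  - by move=> x _; rewrite lee_fin normal_pdf_ge0.
  - exact: measurable_EFin_normal_pdf.
  - by apply: measurable_funeM; exact: measurable_EFin_normal_pdf.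
  - move=> x ux; rewrite -EFinM lee_fin (normal_pdfE _ s0) (normal_pdfE _ s'0).
    rewrite /C mulrACA mulrA divfK ?gt_eqF ?normal_peak_gt0// -!mulrA.
    rewrite ler_pM2l ?normal_peak_gt0// /normal_fun -expRD ler_expR s'2 subr0.
    rewrite -mulrnA.
    rewrite (_ : - x ^+ 2 / (s ^+ 2 *+ 2) = (- x ^+ 2 - x ^+ 2) / (s ^+ 2 *+ 4)).
      by rewrite -mulrDl ler_pM2r ?invr_gt0 ?mulrn_wgt0//; lra.
    by field.
rewrite ge0_integralZl_EFin//=; last exact: measurable_EFin_normal_pdf.
  2: by move=> x _; rewrite lee_fin normal_pdf_ge0.
rewrite -[leRHS]mule1; apply: lee_wpmul2l; rewrite ?lee_fin//.
rewrite -(integral_normal_pdf 0 s').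
apply: ge0_subset_integral => //=; first exact: measurable_EFin_normal_pdf.
by move=> x _; rewrite lee_fin normal_pdf_ge0.
Qed.

(** * Discs and tails for a shifted Gaussian law on the plane *)

Definition sqnorm {R : realType} (z : R * R) : R := z.1 ^+ 2 + z.2 ^+ 2.

Lemma sqnorm_ge0 (R : realType) (z : R * R) : 0 <= sqnorm z.
Proof. by rewrite addr_ge0 ?sqr_ge0. Qed.

Lemma measurable_sqnorm (R : realType) :
  measurable_fun [set: R * R] (@sqnorm R).
Proof. by apply: measurable_funD; apply: measurable_funX. Qed.

Lemma measurable_sqnorm_le (R : realType) (u : R) :
  measurable [set z : R * R | sqnorm z <= u].
Proof.
rewrite -[X in measurable X]setTI.
by apply: (measurable_fun_le (f := @sqnorm R) (g := cst u)) => //;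
  exact: measurable_sqnorm.
Qed.

Lemma measurable_sqnorm_ge (R : realType) (u : R) :
  measurable [set z : R * R | u <= sqnorm z].
Proof.
rewrite -[X in measurable X]setTI.
by apply: (measurable_fun_le (f := cst u) (g := @sqnorm R)) => //;
  exact: measurable_sqnorm.
Qed.

(** Translation by the line-of-sight component of a channel, whose real and imaginary parts are [a]
    and [b]. *)
Definition shift {R : realType} (a b : R) (z : R * R) : R * R := (a + z.1, b + z.2).

Lemma measurable_shift (R : realType) (a b : R) :
  measurable_fun [set: R * R] (shift a b).
Proof.
apply/measurable_fun_pairP; split; exact: measurable_funD.
Qed.

(** The channel is its deterministic component plus [w], so an event about [X] is a translated event
    about [w]. Positivity of [Omega] and [K + 1] makes [s] nonzero, which keeps the law Gaussian. *)
Lemma rician_law (R : realType) (d : measure_display) (T : measurableType d)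
    (P : probability T R) (K Omega : R) (X : T -> R[i]) :
  0 <= K -> 0 < Omega -> rician P K Omega X ->
  measurable_fun [set: T] (@ReIm R \o X) /\
  exists a b s : R, s != 0 /\ forall B, measurable B ->
    P ((@ReIm R \o X) @^-1` B) =
    (normal_prob 0 s \x normal_prob 0 s)%E (shift a b @^-1` B).
Proof.
move=> K0 O0 [th [w [[mw lw] Xw]]].
set k := Num.sqrt _ in Xw.
have XE : @ReIm R \o X = shift (k * cos th) (k * sin th) \o (@ReIm R \o w).
  apply/funext => t /=; rewrite Xw /ReIm /shift /expi /=.
  by case: (w t) => x y /=; rewrite !mul0r subr0 addr0.
split.
  by rewrite XE; apply: measurableT_comp => //; exact: measurable_shift.
exists (k * cos th), (k * sin th), (Num.sqrt (Omega / (K + 1) / 2)); split.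
  by rewrite gt_eqF// sqrtr_gt0 !divr_gt0// ltr_wpDl.
move=> B mB; rewrite XE comp_preimage lw//.
by rewrite -[X in measurable X]setTI; exact: measurable_shift.
Qed.

(** The disc lies in the concentric square of half-side [sqrt u], and each side contributes a factor
    of order [sqrt u]. *)
Lemma normal_prob2_disc_le (R : realType) (a b s : R) : s != 0 ->
  exists2 C : R, 0 < C & forall u : R, 0 <= u ->
    ((normal_prob 0 s \x normal_prob 0 s)
      (shift a b @^-1` [set z | (sqnorm z <= u)%R]) <= (C * u)%R%:E)%E.
Proof.
move=> s0; exists ((normal_peak s *+ 2) ^+ 2).
  by rewrite exprn_gt0// mulrn_wgt0// normal_peak_gt0.
move=> u u0; set r := Num.sqrt u.
have r0 : 0 <= r by exact: sqrtr_ge0.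
have r2 : r ^+ 2 = u by rewrite sqr_sqrtr.
pose I c := [set` `[(c - r)%R, (c + r)%R]] : set R.
apply: (@le_trans _ _ ((normal_prob 0 s \x normal_prob 0 s)%E (I (- a) `*` I (- b)))).
  apply: le_measure; rewrite ?inE.
  - rewrite -[X in measurable X]setTI; apply: measurable_shift => //.
    exact: measurable_sqnorm_le.
  - by apply: measurableX; exact: measurable_itv.
  - have dist (c t v : R) : 0 <= v -> (c + t) ^+ 2 + v <= u -> I (- c) t.
      move=> v0 ctv; have : `|c + t| <= r.
        by rewrite -(@ler_pXn2r _ 2)// ?nnegrE// real_normK ?num_real// r2; lra.
      by rewrite ler_norml => h; rewrite /I /= in_itv /=; lra.
    move=> [x y]; rewrite /sqnorm /shift /= => xyu; split => /=.
      by apply: dist xyu; exact: sqr_ge0.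
    by apply: (dist b y ((a + x) ^+ 2)); rewrite ?sqr_ge0// addrC.
rewrite product_measure1E ?[I _]/I; [|exact: measurable_itv..].
rewrite -[in leRHS]r2.
rewrite (_ : (normal_peak s *+ 2) ^+ 2 * r ^+ 2 =
  (normal_peak s * (r *+ 2)) * (normal_peak s * (r *+ 2))); last by ring.
by rewrite EFinM; apply: lee_pmul; rewrite ?measure_ge0//; exact: normal_prob_itv_le.
Qed.

(** The disc contains the concentric square of half-side [sqrt (u / 2)]. For [u <= 1] this half-side
    is at most [1], where the one-dimensional lower bound holds. *)
Lemma normal_prob2_disc_ge (R : realType) (a b s : R) : s != 0 ->
  exists2 c : R, 0 < c & forall u : R, 0 <= u <= 1 ->
    ((c * u)%R%:E <= (normal_prob 0 s \x normal_prob 0 s)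
      (shift a b @^-1` [set z | (sqnorm z <= u)%R]))%E.
Proof.
move=> s0.
have [c c0 hc] := normal_prob_itv_ge (- a) s0.
have [c' c'0 hc'] := normal_prob_itv_ge (- b) s0.
exists (c * c' / 2); first by rewrite divr_gt0// mulr_gt0.
move=> u /andP[u0 u1]; set r := Num.sqrt (u / 2).
have r0 : 0 <= r by exact: sqrtr_ge0.
have r2 : r ^+ 2 = u / 2 by rewrite sqr_sqrtr// divr_ge0.
have r1 : 0 <= r <= 1.
  by rewrite r0 -(@ler_pXn2r _ 2)// ?nnegrE// expr1n r2; lra.
pose I c := [set` `[(c - r)%R, (c + r)%R]] : set R.
apply: (@le_trans _ _ ((normal_prob 0 s \x normal_prob 0 s)%E (I (- a) `*` I (- b)))).
  rewrite product_measure1E ?[I _]/I; [|exact: measurable_itv..].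
  rewrite (_ : c * c' / 2 * u = (c * r) * (c' * r)); last first.
    by rewrite mulrACA -expr2 r2; ring.
  rewrite EFinM; apply: lee_pmul; rewrite ?lee_fin ?mulr_ge0 ?(ltW c0) ?(ltW c'0)//.
    exact: hc.
  exact: hc'.
apply: le_measure; rewrite ?inE.
- by apply: measurableX; exact: measurable_itv.
- rewrite -[X in measurable X]setTI; apply: measurable_shift => //.
  exact: measurable_sqnorm_le.
- have dist (e t : R) : I (- e) t -> (e + t) ^+ 2 <= u / 2.
    rewrite /I /= in_itv /= => h.
    rewrite -r2 -real_normK ?num_real//.
    by rewrite ler_pXn2r// ?nnegrE// ler_norml; lra.
  move=> [x y] [/= /dist ax /dist bY]; rewrite /sqnorm /shift /=; lra.
Qed.

(** A point far from the shifted centre has a large coordinate, so two one-dimensional tails cover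
    the event. *)
Lemma normal_prob2_tail (R : realType) (a b s : R) : s != 0 ->
  exists C k : R, [/\ 0 < C, 0 < k & forall u : R,
    ((normal_prob 0 s \x normal_prob 0 s)
      (shift a b @^-1` [set z | (u <= sqnorm z)%R]) <=
     (C * expR (- (k * u)))%R%:E)%E].
Proof.
move=> s0; have [C C0 hC] := normal_prob_tail s0.
have s2 : 0 < s ^+ 2 by rewrite exprn_even_gt0.
(* These constants split [expR (- v / (s ^+ 2 *+ 4))], for the [v] below, into its constant part and
   its decay in [u]; the final [*+ 2] counts the two coordinates. *)
exists (C * expR ((a ^+ 2 + b ^+ 2) / (s ^+ 2 *+ 8)) *+ 2), (s ^+ 2 *+ 16)^-1; split.
- by rewrite mulrn_wgt0// mulr_gt0// expR_gt0.
- by rewrite invr_gt0 mulrn_wgt0.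
(* Since [(a + x) ^+ 2 <= (a ^+ 2 + x ^+ 2) *+ 2], having [x ^+ 2] and [y ^+ 2] both below [v] would
   put the squared norm of the shifted point below [u]. *)
move=> u; pose v := (u / 2 - (a ^+ 2 + b ^+ 2)) / 2.
have mt : measurable [set x : R | v <= x ^+ 2].
  rewrite -[X in measurable X]setTI.
  by apply: (measurable_fun_le (f := cst v) (g := fun x : R => x ^+ 2)).
set A := [set x : R | v <= x ^+ 2] in mt.
apply: (@le_trans _ _ ((normal_prob 0 s \x normal_prob 0 s)%E
    (A `*` setT `|` setT `*` A))).
  apply: le_measure; rewrite ?inE.
  - rewrite -[X in measurable X]setTI; apply: measurable_shift => //.
    exact: measurable_sqnorm_ge.
  - by apply: measurableU; exact: measurableX.
  - move=> [x y]; rewrite /sqnorm /shift /A /= => uxy.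
    have [vx|xv] := leP v (x ^+ 2); [by left|right; split=> //=].
    have := sqr_ge0 (a - x); have := sqr_ge0 (b - y).
    rewrite /v in xv *; nra.
apply: (@le_trans _ _ ((normal_prob 0 s \x normal_prob 0 s) (A `*` setT) +
    (normal_prob 0 s \x normal_prob 0 s) (setT `*` A))%E).
  by apply: measureU2; exact: measurableX.
rewrite !product_measure1E//= !probability_setT mule1 mul1e.
apply: le_trans (leeD (hC v) (hC v)) _.
rewrite -EFinD lee_fin -mulr2n mulrnAl lerMn2r/= -mulrA ler_pM2l// -expRD ler_expR.
rewrite le_eqVlt; apply/orP; left; apply/eqP; rewrite /v.
by field.
Qed.

(** * Fading bounds common to all links *)

(* The same [C] serves in all bounds, which are weakened by increasing [C]: this
   gives a constant common to finitely many links. *)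
Definition fading_bounds {R : realType} {d : measure_display}
    {T : measurableType d} (P : probability T R) (X : T -> R * R) (C : R) : Prop :=
  [/\ forall u : R, 0 <= u ->
        (P (X @^-1` [set z | (sqnorm z <= u)%R]) <= (C * u)%R%:E)%E,
      forall u : R, 0 <= u <= 1 ->
        ((u / C)%R%:E <= P (X @^-1` [set z | (sqnorm z <= u)%R]))%E &
      forall u : R, 0 <= u ->
        (P (X @^-1` [set z | (u <= sqnorm z)%R]) <= (C * expR (- (u / C)))%R%:E)%E].

Lemma fading_bounds_le (R : realType) (d : measure_display)
    (T : measurableType d) (P : probability T R) (X : T -> R * R) (C C' : R) :
  0 < C -> C <= C' -> fading_bounds P X C -> fading_bounds P X C'.
Proof.
move=> C0 CC' [ub lb tl]; have C'0 : 0 < C' by exact: lt_le_trans CC'.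
have iC : C'^-1 <= C^-1 by rewrite lef_pV2.
split=> u u0.
- by apply: le_trans (ub _ u0) _; rewrite lee_fin ler_wpM2r.
- apply: le_trans (lb _ u0); rewrite lee_fin ler_wpM2l//.
  by case/andP: u0.
- apply: le_trans (tl _ u0) _; rewrite lee_fin ler_pM ?expR_ge0 ?(ltW C0)//.
  by rewrite ler_expR lerN2 ler_wpM2l.
Qed.

Lemma rician_fading_bounds (R : realType) (d : measure_display)
    (T : measurableType d) (P : probability T R) (K Omega : R) (X : T -> R[i]) :
  0 <= K -> 0 < Omega -> rician P K Omega X ->
  exists2 C : R, 0 < C & fading_bounds P (@ReIm R \o X) C.
Proof.
move=> K0 O0 /(rician_law K0 O0)[_ [a [b [s [s0 lX]]]]].
have [C1 C10 ub] := normal_prob2_disc_le a b s0.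
have [C2 C20 lb] := normal_prob2_disc_ge a b s0.
have [C3 [k [C30 k0 tl]]] := normal_prob2_tail a b s0.
have C2i : 0 < C2^-1 by rewrite invr_gt0.
have ki : 0 < k^-1 by rewrite invr_gt0.
(* The sum dominates each of the four terms, as the three bounds require; [C2] and [k] enter
   inverted because [fading_bounds] divides by [C] there. *)
pose C := C1 + C2^-1 + C3 + k^-1.
have C0 : 0 < C by rewrite !addr_gt0.
exists C => //; split=> u u0.
- rewrite lX; last exact: measurable_sqnorm_le.
  by apply: le_trans (ub _ u0) _; rewrite lee_fin ler_wpM2r// /C; lra.
- rewrite lX; last exact: measurable_sqnorm_le.
  apply: le_trans (lb _ u0); rewrite lee_fin mulrC; case/andP: u0 => u0 _.
  rewrite ler_wpM2r// -(invrK C2) lef_pV2// /C; lra.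
- rewrite lX; last exact: measurable_sqnorm_ge.
  apply: le_trans (tl _) _; rewrite lee_fin ler_pM ?expR_ge0 ?(ltW C30)//.
    by rewrite /C; lra.
  rewrite ler_expR lerN2 mulrC ler_wpM2r// -(invrK k) lef_pV2// /C; lra.
Qed.

Lemma fading_bounds_uniform (R : realType) (d : measure_display)
    (T : measurableType d) (P : probability T R) (I : finType)
    (X : I -> T -> R * R) :
  (forall i, exists2 C : R, 0 < C & fading_bounds P (X i) C) ->
  exists2 C : R, 1 <= C & forall i, fading_bounds P (X i) C.
Proof.
move=> hX; have /choice[c hc] i : exists C : R, 0 < C /\ fading_bounds P (X i) C.
  by have [C ? ?] := hX i; exists C.
(* The extra [1] ensures [1 <= C], on which the bound for level [0] relies. *)
exists (1 + \sum_i c i).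
  by rewrite lerDl sumr_ge0// => i _; apply/ltW; have [] := hc i.
move=> i; have [ci0 hi] := hc i; apply: (fading_bounds_le ci0) hi.
rewrite (bigD1 i)//= addrCA lerDl addr_ge0// sumr_ge0// => j _.
by apply/ltW; have [] := hc j.
Qed.

(** * From power bounds to the diversity order *)

(** After taking logarithms and dividing by [ln p], the constants vanish in the limit and the loss
    [e] in the exponent is arbitrary. Half of the tolerance goes to each. *)
Lemma has_diversity_order_squeeze (R : realType) (f : R -> R) (M : R) :
  (exists2 c : R, 0 < c & \forall p \near +oo, c * p `^ (- M) <= f p) ->
  (forall e : R, 0 < e ->
    exists2 C : R, 0 < C & \forall p \near +oo, f p <= C * p `^ (- M + e)) ->
  has_diversity_order f M.
Proof.
move=> [c c0 lb] ub; rewrite /has_diversity_order.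
apply/cvgrPdist_le => e e0.
have e2 : 0 < e / 2 by rewrite divr_gt0.
have [C C0 {}ub] := ub _ e2.
(* This threshold makes [|ln A| <= e / 2 * ln p]; the [+ 1] also makes [ln p] positive. *)
have big (A : R) : \forall p \near +oo, `|A| / (e / 2) + 1 <= ln p.
  exists (expR (`|A| / (e / 2) + 1)); split; first exact: num_real.
  move=> p /ltW h; rewrite -[leLHS]expRK ler_ln// posrE ?expR_gt0//.
  exact: lt_le_trans (expR_gt0 _) h.
near=> p.
have p0 : 0 < p by near: p; exact: nbhs_pinfty_gt.
have L1 : `|ln c| / (e / 2) + 1 <= ln p by near: p; exact: big.
have L2 : `|ln C| / (e / 2) + 1 <= ln p by near: p; exact: big.
have lp0 : 0 < ln p by apply: lt_le_trans L1; rewrite ltr_wpDl// divr_ge0// ltW.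
have lnle (A : R) : `|ln A| / (e / 2) + 1 <= ln p -> `|ln A| <= e / 2 * ln p.
  by move=> h; rewrite mulrC -ler_pdivrMr//; lra.
have fl : c * p `^ (- M) <= f p by near: p; exact: lb.
have fu : f p <= C * p `^ (- M + e / 2) by near: p; exact: ub.
have f0 : 0 < f p by apply: lt_le_trans fl; rewrite mulr_gt0// powR_gt0.
have lfl : ln c - M * ln p <= ln (f p).
  rewrite -mulNr -ln_powR -lnM ?posrE ?powR_gt0//.
  by rewrite ler_ln ?posrE ?mulr_gt0 ?powR_gt0.
have lfu : ln (f p) <= ln C + (- M + e / 2) * ln p.
  rewrite -ln_powR -lnM ?posrE ?powR_gt0//.
  by rewrite ler_ln ?posrE ?mulr_gt0 ?powR_gt0.
have := lnle _ L1; have := lnle _ L2; rewrite !ler_norml.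
move=> /andP[A1 A2] /andP[B1 B2].
rewrite (_ : - M - _ = (- M * ln p - ln (f p)) / ln p); last by field; rewrite gt_eqF.
rewrite ler_pdivlMr// ler_pdivrMr//; nra.
Unshelve. all: by end_near. Qed.

(** * Probability that all products of gains are small *)

Lemma lee_prod (R : realType) (I : finType) (F G : I -> \bar R) :
  (forall i, (0 <= F i <= G i)%E) -> (\prod_i F i <= \prod_i G i)%E.
Proof.
move=> FG; suff /andP[] : (0 <= \prod_i F i <= \prod_i G i)%E by [].
elim/big_ind2 : _ => [|x1 x2 y1 y2 /andP[x10 x12] /andP[y10 y12]|i _].
- by rewrite lee01 lexx.
- by rewrite mule_ge0//= lee_pmul.
- exact: FG.
Qed.

Lemma measure_bigsetU_le (R : realType) (d : measure_display)
    (T : measurableType d) (mu : {measure set T -> \bar R}) (I : finType)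
    (A : I -> set T) :
  (forall i, measurable (A i)) ->
  (mu (\big[setU/set0]_i A i) <= \sum_i mu (A i))%E.
Proof.
move=> mA; suff [] : measurable (\big[setU/set0]_i A i) /\
  (mu (\big[setU/set0]_i A i) <= \sum_i mu (A i))%E by [].
elim/big_rec2 : _ => [|i y B _ [mB By]]; first by rewrite measure0.
split; first exact: measurableU.
by apply: le_trans (measureU2 _ _ _) _ => //; exact: leeD.
Qed.

Lemma small_product_levels (R : realFieldType) (x y q : R) (n : nat) :
  0 <= x -> 0 <= y -> 0 < q -> x * y <= q ^+ n.+1 ->
  exists i : 'I_n.+1, (i == 0%N :> nat) || (x <= q ^+ i) /\
    ((n - i)%N == 0%N) || (y <= q ^+ (n - i)).
Proof.
move=> x0 y0 q0; elim: n y y0 => [|n IH] y y0 xy; first by exists ord0.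
have [xq|qx] := leP x (q ^+ n.+1).
  by exists ord_max; rewrite /= subnn xq.
have [|i [xi yi]] := IH (y / q) (divr_ge0 y0 (ltW q0)).
  by rewrite mulrA ler_pdivrMr// -exprSr.
exists (widen_ord (leqnSn _) i); split => //=.
have in1 : (i <= n)%N by rewrite -ltnS ltn_ord.
(* If [n - i = 0], the induction hypothesis says nothing about [y]; then [y <= q] follows from
   [q ^+ n.+1 < x] and the bound on the product. *)
rewrite subSn//=; case/orP: yi => [/eqP ->|yq]; last first.
  by rewrite exprSr -ler_pdivrMr.
rewrite expr1 -(@ler_pM2l _ (q ^+ n.+1)) ?exprn_gt0// -exprSr.
by apply: le_trans xy; rewrite ler_wpM2r// ltW.
Qed.

(** Independence in product form for the channels of one user: [X] will be the element-to-user links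
    and [Y] the base-station links. *)
Definition independent_links {R : realType} {d : measure_display}
    {T : measurableType d} (P : probability T R) {M : nat}
    (X Y : 'I_M -> T -> R * R) : Prop :=
  forall A B : 'I_M -> set (R * R),
    (forall m, measurable (A m)) -> (forall m, measurable (B m)) ->
    P [set t | forall m, A m (X m t) /\ B m (Y m t)] =
    (\prod_m (P (X m @^-1` A m) * P (Y m @^-1` B m)))%E.

(* Level [0] is the whole plane, so that the bound [C q^i] on its probability
   holds for [i = 0] too. *)
Definition level_set {R : realType} (q : R) (i : nat) : set (R * R) :=
  if i == 0%N then setT else [set z | sqnorm z <= q ^+ i].

Lemma measurable_level_set (R : realType) (q : R) (i : nat) :
  measurable (level_set q i).
Proof. by rewrite /level_set; case: ifP => // _; exact: measurable_sqnorm_le. Qed.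

Lemma level_set_prob (R : realType) (d : measure_display)
    (T : measurableType d) (P : probability T R) (X : T -> R * R) (C q : R)
    (i : nat) : 1 <= C -> 0 < q -> fading_bounds P X C ->
  (P (X @^-1` level_set q i) <= (C * q ^+ i)%R%:E)%E.
Proof.
move=> C1 q0 [ub _ _]; rewrite /level_set; case: ifP => [/eqP ->|_].
  by rewrite preimage_setT probability_setT expr0 mulr1 lee_fin.
by apply: ub; rewrite exprn_ge0// ltW.
Qed.

Lemma measurable_links (R : realType) (d : measure_display)
    (T : measurableType d) (M : nat) (X Y : 'I_M -> T -> R * R)
    (A B : 'I_M -> set (R * R)) :
  (forall m, measurable_fun setT (X m)) -> (forall m, measurable_fun setT (Y m)) ->
  (forall m, measurable (A m)) -> (forall m, measurable (B m)) ->
  measurable [set t | forall m, A m (X m t) /\ B m (Y m t)].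
Proof.
move=> mX mY mA mB.
rewrite (_ : [set _ | _] =
  \bigcap_(m in [set: 'I_M]) (X m @^-1` A m `&` Y m @^-1` B m)); last first.
  by apply/seteqP; split=> [t h m _|t h m]; [exact: h|exact: (h m I)].
apply: fin_bigcap_measurable => // m _.
by apply: measurableI; rewrite -[X in measurable X]setTI; [exact: mX|exact: mY].
Qed.

Lemma measurable_small_products (R : realType) (d : measure_display)
    (T : measurableType d) (M : nat) (X Y : 'I_M -> T -> R * R) (u : R) :
  (forall m, measurable_fun setT (X m)) -> (forall m, measurable_fun setT (Y m)) ->
  measurable [set t | forall m, sqnorm (X m t) * sqnorm (Y m t) <= u].
Proof.
move=> mX mY.
rewrite (_ : [set _ | _] = \bigcap_(m in [set: 'I_M])
  [set t | sqnorm (X m t) * sqnorm (Y m t) <= u]); last first.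
  by apply/seteqP; split=> [t h m _|t h m]; [exact: h|exact: (h m I)].
apply: fin_bigcap_measurable => // m _.
rewrite -[X in measurable X]setTI.
apply: (measurable_fun_le (f := fun t => sqnorm (X m t) * sqnorm (Y m t))
  (g := cst u)) => //.
by apply: measurable_funM; apply: measurableT_comp => //; exact: measurable_sqnorm.
Qed.

(** Union bound over the [n.+1 ^ M] assignments of levels to elements. By independence each
    assignment costs at most [C * q ^+ i * (C * q ^+ (n - i))] per element, in which [i] cancels. *)
Lemma small_products_prob (R : realType) (d : measure_display)
    (T : measurableType d) (P : probability T R) (M : nat)
    (X Y : 'I_M -> T -> R * R) (C q : R) (n : nat) :
  (forall m, measurable_fun setT (X m)) -> (forall m, measurable_fun setT (Y m)) ->
  independent_links P X Y ->
  1 <= C -> (forall m, fading_bounds P (X m) C) ->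
  (forall m, fading_bounds P (Y m) C) -> 0 < q ->
  (P [set t | forall m, (sqnorm (X m t) * sqnorm (Y m t) <= q ^+ n.+1)%R] <=
   ((n.+1 ^ M)%:R * (C ^+ 2 * q ^+ n) ^+ M)%R%:E)%E.
Proof.
move=> mX mY iXY C1 bX bY q0.
pose E (k : {ffun 'I_M -> 'I_n.+1}) := [set t | forall m,
  level_set q (k m) (X m t) /\ level_set q (n - k m) (Y m t)].
have mE k : measurable (E k).
  by apply: (measurable_links (A := fun m => level_set q (k m))
    (B := fun m => level_set q (n - k m))) => // m; exact: measurable_level_set.
have C0 : 0 <= C by exact: le_trans C1.
have PE k : (P (E k) <= ((C ^+ 2 * q ^+ n) ^+ M)%R%:E)%E.
  rewrite (iXY (fun m => level_set q (k m)) (fun m => level_set q (n - k m)));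
    try by move=> m; exact: measurable_level_set.
  apply: (@le_trans _ _ (\prod_(m < M) (C ^+ 2 * q ^+ n)%R%:E)%E); last first.
    by rewrite prodEFin prodr_const card_ord.
  apply: lee_prod => m; rewrite mule_ge0//= .
  apply: (@le_trans _ _ ((C * q ^+ k m)%R%:E * (C * q ^+ (n - k m))%R%:E)%E).
    by apply: lee_pmul => //; [exact: (level_set_prob _ C1 q0 (bX m))|
      exact: (level_set_prob _ C1 q0 (bY m))].
  rewrite -EFinM mulrACA -exprD subnKC ?expr2// -ltnS; exact: ltn_ord.
apply: (@le_trans _ _ (P (\big[setU/set0]_k E k))).
  apply: le_measure; rewrite ?inE.
  - exact: measurable_small_products.
  - by apply: bigsetU_measurable.
  - move=> t /= ht.
    have /choice[k hk] m := small_product_levels (sqnorm_ge0 (X m t))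
      (sqnorm_ge0 (Y m t)) q0 (ht m).
    rewrite (bigD1 (finfun k))//=; left => m; rewrite /level_set ffunE.
    have [hx hy] := hk m.
    by split; case: ifPn => //= h0; [move: hx|move: hy]; rewrite (negbTE h0).
apply: le_trans (measure_bigsetU_le P mE) _.
apply: le_trans (lee_sum _ (fun k _ => PE k)) _.
by rewrite sumEFin sumr_const card_ffun !card_ord mulr_natl.
Qed.

(** * Deterministic conditions for outage *)

Lemma sqnorm_ReIm (R : realType) (z : R[i]) : sqnorm (ReIm z) = normc z ^+ 2.
Proof. by case: z => x y; rewrite /sqnorm /ReIm /= sqr_sqrtr// addr_ge0 ?sqr_ge0. Qed.

Lemma normc_ge0 (R : realType) (z : R[i]) : 0 <= normc z.
Proof. by case: z => x y; exact: sqrtr_ge0. Qed.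

Lemma normc_expi (R : realType) (t : R) : normc (expi t) = 1.
Proof. by rewrite /expi /= cos2Dsin2 sqrtr1. Qed.

Lemma normc_real (R : realType) (x : R) : normc x%:C = `|x|.
Proof. by rewrite /= expr0n addr0 sqrtr_sqr. Qed.

Lemma normrE_normc (R : realType) (z : R[i]) : `|z| = (normc z)%:C.
Proof. by rewrite normc_def; case: z. Qed.

Lemma normc_sum_le (R : realType) (I : finType) (F : I -> R[i]) :
  normc (\sum_i F i) <= \sum_i normc (F i).
Proof.
elim/big_ind2 : _ => [|x1 x2 y1 y2 h1 h2|//]; first by rewrite normc0.
by apply: le_trans (le_normcD _ _) _; exact: lerD.
Qed.

(** Cophasing makes every term of the numerator sum real and nonnegative, so its modulus is the sum
    itself; the denominator is positive and can be cleared. *)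
Lemma snr_lt (R : realType) (T : Type) (M : nat) (g h : 'I_M -> T -> R[i])
    (phi : 'I_M -> T -> R) (G sv2 su2 p target : R) (t : T) :
  0 <= sv2 -> 0 < su2 -> 0 <= G -> cophase g h phi ->
  (snr g h phi G sv2 su2 p t < target) =
  (p * (G * \sum_m normc (h m t) * normc (g m t)) ^+ 2 <
   target * (normc (\sum_m h m t * G%:C * expi (phi m t)) ^+ 2 * sv2 + su2)).
Proof.
move=> sv su G0 co; rewrite /snr.
rewrite (_ : \sum_m _ = (G * \sum_m normc (h m t) * normc (g m t))%:C); last first.
  rewrite rmorphM rmorph_sum mulr_sumr; apply: eq_bigr => m _.
  by rewrite rmorphM /= -!normrE_normc -co; ring.
rewrite normc_real ger0_norm; last first.
  by rewrite mulr_ge0// sumr_ge0// => m _; rewrite mulr_ge0// normc_ge0.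
by rewrite ltr_pdivrMr// ltr_wpDl// mulr_ge0// sqr_ge0.
Qed.

(** Each product of gains is at most the whole cophased sum, while the triangle inequality bounds
    the noise sum by [G * M%:R * sqrt L], whatever the phases. *)
Lemma outage_small_products (R : realType) (T : Type) (M : nat)
    (g h : 'I_M -> T -> R[i]) (phi : 'I_M -> T -> R)
    (G sv2 su2 p target L : R) (t : T) :
  0 <= sv2 -> 0 < su2 -> 0 < G -> 0 < p -> 0 < target -> 0 <= L ->
  cophase g h phi -> snr g h phi G sv2 su2 p t < target ->
  (forall m, normc (h m t) ^+ 2 <= L) ->
  forall m, normc (h m t) ^+ 2 * normc (g m t) ^+ 2 <=
    target * (M%:R ^+ 2 * L * sv2 + su2 / G ^+ 2) / p.
Proof.
move=> sv su G0 p0 t0 L0 co; rewrite (snr_lt _ _ _ sv su (ltW G0) co) => out hL m.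
set S1 := \sum_m _ in out; set S2 := \sum_m _ in out.
have le1 : normc (h m t) * normc (g m t) <= S1.
  rewrite /S1 (bigD1 m)//= lerDl sumr_ge0// => k _.
  by rewrite mulr_ge0// normc_ge0.
have le2 : normc S2 <= G * M%:R * Num.sqrt L.
  apply: le_trans (normc_sum_le _) _.
  apply: (@le_trans _ _ (\sum_(k < M) G * Num.sqrt L)); last first.
    by rewrite sumr_const card_ord -mulr_natl; lra.
  apply: ler_sum => k _; rewrite !normcM normc_expi normc_real mulr1 mulrC.
  rewrite gtr0_norm// ler_pM2l// -(@ler_pXn2r _ 2)// ?nnegrE ?normc_ge0//.
  by rewrite sqr_sqrtr.
have le2' : normc S2 ^+ 2 <= G ^+ 2 * M%:R ^+ 2 * L.
  rewrite -[in leRHS](sqr_sqrtr L0) -!exprMn.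
  by rewrite ler_pXn2r// ?nnegrE ?normc_ge0// !mulr_ge0// ltW.
have le1' : (normc (h m t) * normc (g m t)) ^+ 2 <= S1 ^+ 2.
  by rewrite ler_pXn2r// ?nnegrE ?(le_trans _ le1)// mulr_ge0// normc_ge0.
rewrite -exprMn; apply: le_trans le1' _.
rewrite ler_pdivlMr// -(@ler_pM2l _ (G ^+ 2)) ?exprn_gt0//.
apply: (@le_trans _ _ (p * (G * S1) ^+ 2)).
  by rewrite le_eqVlt exprMn; apply/orP; left; apply/eqP; ring.
apply/ltW/(lt_le_trans out).
rewrite (_ : G ^+ 2 * _ = target * (G ^+ 2 * M%:R ^+ 2 * L * sv2 + su2)); last first.
  by field; rewrite gt_eqF.
by rewrite ler_pM2l// lerD2r ler_wpM2r.
Qed.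

(** The cophased sum is at most [M%:R * sqrt u], and the amplified element noise only enlarges the
    denominator, so comparing with [su2] alone suffices. *)
Lemma small_gains_outage (R : realType) (T : Type) (M : nat)
    (g h : 'I_M -> T -> R[i]) (phi : 'I_M -> T -> R)
    (G sv2 su2 p target u : R) (t : T) :
  0 <= sv2 -> 0 < su2 -> 0 < G -> 0 < p -> 0 < target -> 0 <= u ->
  cophase g h phi ->
  p * (G * M%:R) ^+ 2 * u < target * su2 ->
  (forall m, normc (h m t) ^+ 2 <= 1) -> (forall m, normc (g m t) ^+ 2 <= u) ->
  snr g h phi G sv2 su2 p t < target.
Proof.
move=> sv su G0 p0 t0 u0 co pu h1 gu; rewrite (snr_lt _ _ _ sv su (ltW G0) co).
set S1 := \sum_m _; set S2 := \sum_m _.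
have S10 : 0 <= S1 by rewrite sumr_ge0// => k _; rewrite mulr_ge0// normc_ge0.
have le1 : S1 <= M%:R * Num.sqrt u.
  apply: (@le_trans _ _ (\sum_(k < M) Num.sqrt u)); last first.
    by rewrite sumr_const card_ord mulr_natl.
  apply: ler_sum => k _; rewrite -(@ler_pXn2r _ 2)// ?nnegrE ?mulr_ge0 ?normc_ge0//.
  by rewrite sqr_sqrtr// exprMn -[leRHS]mul1r ler_pM// sqr_ge0.
apply: (@le_lt_trans _ _ (p * (G * M%:R) ^+ 2 * u)).
  rewrite -[in leRHS](sqr_sqrtr u0) -mulrA -exprMn ler_pM2l//.
  rewrite ler_pXn2r// ?nnegrE ?mulr_ge0// ?(ltW G0)//.
  by rewrite -mulrA ler_pM2l.
apply: lt_le_trans pu _.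
by rewrite ler_pM2l// lerDr mulr_ge0// sqr_ge0.
Qed.

(** * Independence of the channels of one user *)

Lemma independent_links_user (R : realType) (d : measure_display)
    (T : measurableType d) (P : probability T R) (M : nat)
    (g : 'I_M -> T -> R[i]) (h : user -> 'I_M -> T -> R[i]) (c : user) :
  mutually_independent P (fun l => @ReIm R \o channels g h l) ->
  independent_links P (fun m => @ReIm R \o h c m) (fun m => @ReIm R \o g m).
Proof.
move=> ind A B mA mB.
(* The links of the other user receive the whole plane, hence contribute factors [1] to the product
   over all channels. *)
pose D (l : 'I_M + user * 'I_M) : set (R * R) := match l with
  | inl m => B m | inr (c', m) => if c' == c then A m else setT end.
have mD l : measurable (D l).
  by case: l => [m|[c' m]] /=; [exact: mB|case: ifP].
have := ind [set: _]%SET D (fun l _ => mD l).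
rewrite (_ : \bigcap_(i in _) _ = [set t | forall m,
    A m (ReIm (h c m t)) /\ B m (ReIm (g m t))]); last first.
  apply/seteqP; split=> t /=.
    move=> H m; split.
      by have := H (inr (c, m)); rewrite /= eqxx; apply; exact: finset.in_setT.
    by have := H (inl m); rewrite /=; apply; exact: finset.in_setT.
  move=> H [m|[c' m]] _ /=; first by have [] := H m.
  by case: eqP => [->|//]; have [] := H m.
move=> ->.
rewrite (eq_bigl xpredT); last by move=> l; exact: finset.in_setT.
rewrite big_sumType/= muleC big_split/=; congr (_ * _)%E.
rewrite (eq_bigr (fun p : user * 'I_M =>
  (fun c' m => P ((@ReIm R \o h c' m) @^-1` (if c' == c then A m else setT))) p.1 p.2));
  last by case.
rewrite -(pair_bigA _ (fun c' m =>
  P ((@ReIm R \o h c' m) @^-1` (if c' == c then A m else setT))))/=.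
rewrite (bigD1 c)//= [X in (_ * X)%E]big1 ?mule1.
  by apply: eq_bigr => m _; rewrite eqxx.
move=> c' /negbTE ->; rewrite big1// => m _.
by rewrite preimage_setT probability_setT.
Qed.

(** * Measurability of the outage event *)

Lemma measurable_ReImP (R : realType) (d : measure_display)
    (T : measurableType d) (f : T -> R[i]) :
  measurable_fun [set: T] (@ReIm R \o f) <->
  measurable_fun [set: T] (fun t => complex.Re (f t)) /\
  measurable_fun [set: T] (fun t => complex.Im (f t)).
Proof. by split=> [/measurable_fun_pairP//|h]; exact/measurable_fun_pairP. Qed.

Lemma measurable_ReIm_mul (R : realType) (d : measure_display)
    (T : measurableType d) (f g : T -> R[i]) :
  measurable_fun [set: T] (@ReIm R \o f) -> measurable_fun [set: T] (@ReIm R \o g) ->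
  measurable_fun [set: T] (@ReIm R \o (fun t => f t * g t)).
Proof.
move=> /measurable_ReImP[rf jf] /measurable_ReImP[rg jg].
apply/measurable_ReImP; split.
  rewrite (_ : (fun t => _) = (fun t => complex.Re (f t) * complex.Re (g t) -
    complex.Im (f t) * complex.Im (g t))).
    by apply: measurable_funB; apply: measurable_funM.
  by apply/funext => t; case: (f t); case: (g t).
rewrite (_ : (fun t => _) = (fun t => complex.Re (f t) * complex.Im (g t) +
  complex.Im (f t) * complex.Re (g t))).
  by apply: measurable_funD; apply: measurable_funM.
by apply/funext => t; case: (f t); case: (g t).
Qed.

Lemma measurable_ReIm_sum (R : realType) (d : measure_display)
    (T : measurableType d) (I : finType) (f : I -> T -> R[i]) :
  (forall i, measurable_fun [set: T] (@ReIm R \o f i)) ->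
  measurable_fun [set: T] (@ReIm R \o (fun t => \sum_i f i t)).
Proof.
move=> mf; apply/measurable_ReImP; split.
  rewrite (_ : (fun t => _) = (fun t => \sum_i complex.Re (f i t))).
    by apply: measurable_sum => i; have /measurable_ReImP[] := mf i.
  by apply/funext => t; rewrite (raddf_sum (@complex.Re R)).
rewrite (_ : (fun t => _) = (fun t => \sum_i complex.Im (f i t))).
  by apply: measurable_sum => i; have /measurable_ReImP[] := mf i.
by apply/funext => t; rewrite (raddf_sum (@complex.Im R)).
Qed.

Lemma measurable_ReIm_expi (R : realType) (d : measure_display)
    (T : measurableType d) (phi : T -> R) :
  measurable_fun [set: T] phi ->
  measurable_fun [set: T] (@ReIm R \o (fun t => expi (phi t))).
Proof.
move=> mphi; apply/measurable_ReImP; split => /=.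
  apply: (measurableT_comp _ mphi); apply: continuous_measurable_fun.
  exact: continuous_cos.
apply: (measurableT_comp _ mphi); apply: continuous_measurable_fun.
exact: continuous_sin.
Qed.

Lemma measurable_snr_lt (R : realType) (d : measure_display)
    (T : measurableType d) (M : nat) (g h : 'I_M -> T -> R[i])
    (phi : 'I_M -> T -> R) (G sv2 su2 p target : R) :
  0 <= sv2 -> 0 < su2 ->
  (forall m, measurable_fun setT (@ReIm R \o g m)) ->
  (forall m, measurable_fun setT (@ReIm R \o h m)) ->
  (forall m, measurable_fun setT (phi m)) ->
  measurable [set t | snr g h phi G sv2 su2 p t < target].
Proof.
move=> sv su mg mh mphi.
pose S2 t := \sum_m h m t * G%:C * expi (phi m t).
pose S1 t := \sum_m h m t * G%:C * expi (phi m t) * g m t.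
have mS m : measurable_fun setT (@ReIm R \o
    (fun t => h m t * G%:C * expi (phi m t))).
  apply: measurable_ReIm_mul; last exact: measurable_ReIm_expi.
  by apply: measurable_ReIm_mul => //; exact: measurable_cst.
have mS2 : measurable_fun setT (fun t => normc (S2 t) ^+ 2).
  rewrite (_ : (fun t => _) = @sqnorm R \o (@ReIm R \o S2)).
    by apply: measurableT_comp; [exact: measurable_sqnorm|exact: measurable_ReIm_sum].
  by apply/funext => t /=; rewrite sqnorm_ReIm.
have mS1 : measurable_fun setT (fun t => normc (S1 t) ^+ 2).
  rewrite (_ : (fun t => _) = @sqnorm R \o (@ReIm R \o S1)).
    apply: measurableT_comp; first exact: measurable_sqnorm.
    by apply: measurable_ReIm_sum => m; exact: measurable_ReIm_mul.
  by apply/funext => t /=; rewrite sqnorm_ReIm.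
rewrite (_ : [set t | _] = ~` [set t | target * (normc (S2 t) ^+ 2 * sv2 + su2) <=
    p * normc (S1 t) ^+ 2]).
  apply: measurableC; rewrite -[X in measurable X]setTI.
  apply: (measurable_fun_le
    (f := fun t => target * (normc (S2 t) ^+ 2 * sv2 + su2))
    (g := fun t => p * normc (S1 t) ^+ 2)) => //.
    by apply: measurable_funM => //; apply: measurable_funD => //; exact: measurable_funM.
  exact: measurable_funM.
have den0 t : 0 < normc (S2 t) ^+ 2 * sv2 + su2.
  by rewrite ltr_wpDl// mulr_ge0// sqr_ge0.
by apply/seteqP; split => t /=; rewrite /snr ltr_pdivrMr ?den0// ltNge => /negP.
Qed.

(** * Asymptotic bounds on the outage probability *)

Lemma near_affine_ln_le_powR (R : realType) (a b s : R) :
  0 <= a -> 0 <= b -> 0 < s -> \forall p \near +oo, a * ln p + b <= p `^ s.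
Proof.
move=> a0 b0 s0; pose A := a * 2 / s + b.
have A0 : 0 <= A by rewrite addr_ge0// divr_ge0 ?mulr_ge0// ltW.
exists (expR (2 / s * A)); split; first exact: num_real.
move=> p Ap; have p0 : 0 < p by exact: lt_trans (expR_gt0 _) Ap.
pose z := s / 2 * ln p.
have zA : A <= z.
  have : 2 / s * A <= ln p by rewrite -[leLHS]expRK ler_ln ?posrE ?expR_gt0// ltW.
  by rewrite /z -ler_pdivrMl ?divr_gt0// invf_div.
have lz : ln p = 2 / s * z by rewrite /z; field; rewrite gt_eqF.
rewrite -[X in X `^ _]lnK ?posrE// -expRM.
rewrite (_ : ln p * s = z + z) ?expRD; last by rewrite /z; field.
have ez := expR_ge1Dx z; have z0 : 0 <= z by exact: le_trans zA.
rewrite lz; clearbody z.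
have Az : A * z = a * (2 / s * z) + b * z by rewrite /A; ring.
have bz : b <= z by apply: le_trans zA; rewrite /A lerDr divr_ge0 ?mulr_ge0// ltW.
have : A * z <= z * z by rewrite ler_wpM2r.
have : (1 + z) * (1 + z) <= expR z * expR z by rewrite ler_pM ?addr_ge0.
have : 0 <= b * z by rewrite mulr_ge0.
rewrite Az; lra.
Qed.

Lemma outage_lower_bound (R : realType) (d : measure_display)
    (T : measurableType d) (P : probability T R) (M : nat)
    (g h : 'I_M -> T -> R[i]) (phi : 'I_M -> T -> R)
    (C G sv2 su2 target : R) :
  (forall m, measurable_fun setT (@ReIm R \o g m)) ->
  (forall m, measurable_fun setT (@ReIm R \o h m)) ->
  (forall m, measurable_fun setT (phi m)) ->
  independent_links P (fun m => @ReIm R \o h m) (fun m => @ReIm R \o g m) ->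
  1 <= C -> (forall m, fading_bounds P (@ReIm R \o h m) C) ->
  (forall m, fading_bounds P (@ReIm R \o g m) C) ->
  cophase g h phi -> 0 <= sv2 -> 0 < su2 -> 0 < G -> 0 < target ->
  exists2 c : R, 0 < c & \forall p \near +oo,
    c * p `^ (- M%:R) <=
    outage_probability P (snr g h phi G sv2 su2 p) target.
Proof.
move=> mg mh mphi ind C1 bh bg co sv su G0 t0.
have C0 : 0 < C by exact: lt_le_trans C1.
pose D := (G * M%:R) ^+ 2 + target * su2.
have tsu : 0 < target * su2 by rewrite mulr_gt0.
have D0 : 0 < D by rewrite ltr_wpDl// sqr_ge0.
(* [D] dominates both [target * su2] and [(G * M%:R) ^+ 2]: the first gives [r <= 1], needed for the
   lower disc bound, the second gives [rD], which forces outage. *)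
pose r := target * su2 / D / 2.
have r0 : 0 < r by rewrite !divr_gt0.
have r1 : r <= 1.
  rewrite ler_pdivrMr// ler_pdivrMr// /D; have := sqr_ge0 (G * M%:R); lra.
have rD : (G * M%:R) ^+ 2 * r < target * su2.
  rewrite (_ : _ * r = target * su2 * ((G * M%:R) ^+ 2 / D / 2)); last by rewrite /r; ring.
  rewrite -[ltRHS]mulr1 ltr_pM2l// !ltr_pdivrMr// /D.
  have := sqr_ge0 (G * M%:R); lra.
(* Each element contributes [1 / C] for [h] at radius [1] and [r / p / C] for [g]. *)
exists ((r / C ^+ 2) ^+ M); first by rewrite exprn_gt0// divr_gt0// exprn_gt0.
exists 1; split; first exact: num_real.
move=> p p1; have p0 : 0 < p by exact: lt_trans p1.
have u0 : 0 <= r / p by rewrite divr_ge0// ltW.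
have u1 : 0 <= r / p <= 1 by rewrite u0 ler_pdivrMr// mul1r (le_trans r1)// ltW.
have mout : measurable [set t | snr g h phi G sv2 su2 p t < target].
  exact: measurable_snr_lt.
rewrite -lee_fin /outage_probability fineK; last exact: fin_num_measure.
pose E := [set t | forall m, sqnorm (ReIm (h m t)) <= 1 /\ sqnorm (ReIm (g m t)) <= r / p].
have PE : P E = (\prod_m (P ((@ReIm R \o h m) @^-1` [set z | (sqnorm z <= 1)%R]) *
    P ((@ReIm R \o g m) @^-1` [set z | (sqnorm z <= r / p)%R])))%E.
  by apply: (ind (fun=> [set z | (sqnorm z <= 1)%R])
    (fun=> [set z | (sqnorm z <= r / p)%R])) => m; exact: measurable_sqnorm_le.
apply: (@le_trans _ _ (P E)); last first.
  apply: le_measure; rewrite ?inE//.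
    by apply: (measurable_links (A := fun=> [set z | (sqnorm z <= 1)%R])
      (B := fun=> [set z | (sqnorm z <= r / p)%R])) => // m; exact: measurable_sqnorm_le.
  move=> t /= Et; apply: (small_gains_outage (u := r / p)) => //.
  - by rewrite (_ : p * _ * _ = (G * M%:R) ^+ 2 * r)//; field; rewrite gt_eqF.
  - by move=> m; rewrite -sqnorm_ReIm; have [] := Et m.
  - by move=> m; rewrite -sqnorm_ReIm; have [] := Et m.
rewrite PE.
apply: (@le_trans _ _ (\prod_(m < M) (1 / C * (r / p / C))%R%:E)%E).
  rewrite prodEFin prodr_const card_ord powRN powR_mulrn ?(ltW p0)//.
  rewrite -(exprVn p) -exprMn lee_fin.
  rewrite (_ : r / C ^+ 2 / p = 1 / C * (r / p / C))//.
  by field; rewrite !gt_eqF.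
apply: lee_prod => m; rewrite lee_fin; apply/andP; split.
  by apply/ltW; rewrite mulr_gt0 ?divr_gt0.
have iC : 0 <= 1 / C by rewrite ltW// divr_gt0.
have rpC : 0 <= r / p / C by rewrite ltW// !divr_gt0.
rewrite EFinM; apply: lee_pmul; rewrite ?lee_fin//.
  by have [_ lb _] := bh m; apply: lb; rewrite ler01 lexx.
by have [_ lb _] := bg m; apply: lb.
Qed.

Lemma outage_upper_bound (R : realType) (d : measure_display)
    (T : measurableType d) (P : probability T R) (M : nat)
    (g h : 'I_M -> T -> R[i]) (phi : 'I_M -> T -> R)
    (C G sv2 su2 target e : R) :
  (forall m, measurable_fun setT (@ReIm R \o g m)) ->
  (forall m, measurable_fun setT (@ReIm R \o h m)) ->
  (forall m, measurable_fun setT (phi m)) ->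
  independent_links P (fun m => @ReIm R \o h m) (fun m => @ReIm R \o g m) ->
  1 <= C -> (forall m, fading_bounds P (@ReIm R \o h m) C) ->
  (forall m, fading_bounds P (@ReIm R \o g m) C) ->
  cophase g h phi -> 0 <= sv2 -> 0 < su2 -> 0 < G -> 0 < target -> 0 < e ->
  exists2 K : R, 0 < K & \forall p \near +oo,
    outage_probability P (snr g h phi G sv2 su2 p) target <=
    K * p `^ (- M%:R + e).
Proof.
move=> mg mh mphi ind C1 bh bg co sv su G0 t0 e0.
have C0 : 0 < C by exact: lt_le_trans C1.
(* Since [n ^+ 2 / (n + 1) ^+ 2 >= 1 - 2 / (n + 1)], this choice keeps the loss in the exponent
   [M * n ^+ 2 / (n + 1) ^+ 2] below [e]. *)
have [n ne] : exists n : nat, M%:R * 2 <= e * n.+1%:R.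
  exists (Num.truncn (M%:R * 2 / e)); rewrite -ler_pdivrMl// mulrC ltW//.
  exact: truncnS_gt.
(* With [L] as chosen below, [(a * ln p + b) / p] is the bound of [outage_small_products]. *)
pose a := target * (M%:R ^+ 2 * (C * M%:R) * sv2).
pose b := target * (su2 / G ^+ 2).
have a0 : 0 <= a by rewrite !mulr_ge0// ltW.
have b0 : 0 <= b by rewrite mulr_ge0 ?divr_ge0 ?exprn_ge0 ?ltW.
have n0 : (0 : R) < n.+1%:R by rewrite ltr0n.
have n'0 : (n.+1%:R : R) != 0 by rewrite gt_eqF.
(* The first term comes from the [M] tails, the second from the level assignments. *)
exists (M%:R * C + (n.+1 ^ M)%:R * (C ^+ 2) ^+ M).
  rewrite ltr_wpDl// ?mulr_ge0 ?(ltW C0)// mulr_gt0 ?ltr0n ?expn_gt0//.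
  by rewrite !exprn_gt0.
near=> p.
have p1 : 1 < p by near: p; exact: nbhs_pinfty_gt.
have p0 : 0 < p by exact: lt_trans p1.
have ab : a * ln p + b <= p `^ (n.+1%:R^-1).
  by near: p; apply: near_affine_ln_le_powR; rewrite ?invr_gt0.
have lp : 0 <= ln p by rewrite ln_ge0// ltW.
pose L := C * M%:R * ln p.
have L0 : 0 <= L by rewrite !mulr_ge0// ltW.
pose q := p `^ (- (n%:R / n.+1%:R ^+ 2)).
have q0 : 0 < q by exact: powR_gt0.
have qX k : q ^+ k = p `^ (- (n%:R / n.+1%:R ^+ 2) * k%:R).
  by rewrite powRrM powR_mulrn// ltW.
have mout : measurable [set t | snr g h phi G sv2 su2 p t < target].
  exact: measurable_snr_lt.
rewrite -lee_fin /outage_probability fineK; last exact: fin_num_measure.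
pose S := [set t | forall m,
  sqnorm (ReIm (h m t)) * sqnorm (ReIm (g m t)) <= q ^+ n.+1].
pose Q m := (@ReIm R \o h m) @^-1` [set z | (L <= sqnorm z)%R].
have mS : measurable S by exact: (measurable_small_products _ mh mg).
have mQ m : measurable (Q m).
  by rewrite /Q -[X in measurable X]setTI; apply: mh => //; exact: measurable_sqnorm_ge.
have mQs : measurable (\big[setU/set0]_m Q m) by exact: bigsetU_measurable.
apply: (@le_trans _ _ (P (\big[setU/set0]_m Q m `|` S))).
  apply: le_measure; rewrite ?inE//; first exact: measurableU.
  move=> t /= out.
  have [[m Lm]|hL] := pselect (exists m, L <= sqnorm (ReIm (h m t))).
    by left; rewrite (bigD1 m)//=; left.
  right => m; rewrite !sqnorm_ReIm.
  apply: le_trans (outage_small_products sv su G0 p0 t0 L0 co out _ m) _.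
    move=> k; rewrite -sqnorm_ReIm leNgt; apply/negP => /ltW kL.
    by apply: hL; exists k.
  rewrite ler_pdivrMr// qX.
  rewrite (_ : target * _ = a * ln p + b); last by rewrite /a /b /L; ring.
  apply: le_trans ab _; rewrite -[X in _ * X](powRr1 (ltW p0)) -powRD.
    rewrite le_eqVlt; apply/orP; left; apply/eqP; congr (_ `^ _).
    by rewrite -(natr1 n) in n'0 *; field.
  by apply/implyP => _; rewrite gt_eqF.
apply: le_trans (measureU2 _ _ _) _ => //.
have tail : (P (\big[setU/set0]_m Q m) <= (M%:R * (C * p `^ (- M%:R)))%R%:E)%E.
  apply: le_trans (measure_bigsetU_le P mQ) _.
  apply: (@le_trans _ _ (\sum_(m < M) (C * p `^ (- M%:R))%R%:E)%E); last first.
    by rewrite sumEFin sumr_const card_ord mulr_natl.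
  apply: lee_sum => m _; have [_ _ tl] := bh m.
  apply: le_trans (tl _ L0) _; rewrite lee_fin ler_pM2l//.
  rewrite -[X in _ <= X `^ _]lnK ?posrE// -expRM ler_expR.
  rewrite le_eqVlt; apply/orP; left; apply/eqP.
  by rewrite /L; field; rewrite gt_eqF.
have small := small_products_prob n mh mg ind C1 bh bg q0.
apply: le_trans (leeD tail small) _.
have pw (x y : R) : x <= y -> p `^ x <= p `^ y.
  by move=> xy; rewrite ler_powR// ltW.
rewrite -EFinD lee_fin mulrDl exprMn !mulrA.
apply: lerD; apply: ler_wpM2l; rewrite ?mulr_ge0 ?exprn_ge0 ?(ltW C0)//.
  by apply: pw; lra.
rewrite -exprM qX; apply: pw.
have nn : n.+1%:R = n%:R + 1 :> R by rewrite -natr1.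
have n1 : (0 : R) < n%:R + 1 by rewrite -nn.
rewrite natrM nn; rewrite nn in ne.
(* Expanding [(1 - 1 / (n + 1)) ^+ 2] writes the gap between the exponents as two nonnegative terms,
   the first by [ne]. *)
rewrite -subr_ge0 (_ : _ - _ = (e * (n%:R + 1) - M%:R * 2) / (n%:R + 1) +
    M%:R / (n%:R + 1) ^+ 2); last by field; rewrite gt_eqF.
by rewrite addr_ge0// divr_ge0// ?subr_ge0// ?sqr_ge0// ltW.
Unshelve. all: by end_near. Qed.

(** * The diversity order in both scenarios *)

(** Stated for a single user and its own cophase condition, which the independent scenario supplies
    for both users and the coupled one for user A. *)
Lemma cophase_diversity (R : realType) (d : measure_display)
    (T : measurableType d) (P : probability T R) (M : nat)
    (g h : 'I_M -> T -> R[i]) (phi : 'I_M -> T -> R)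
    (C G sv2 su2 target : R) :
  (forall m, measurable_fun setT (@ReIm R \o g m)) ->
  (forall m, measurable_fun setT (@ReIm R \o h m)) ->
  (forall m, measurable_fun setT (phi m)) ->
  independent_links P (fun m => @ReIm R \o h m) (fun m => @ReIm R \o g m) ->
  1 <= C -> (forall m, fading_bounds P (@ReIm R \o h m) C) ->
  (forall m, fading_bounds P (@ReIm R \o g m) C) ->
  cophase g h phi -> 0 <= sv2 -> 0 < su2 -> 0 < G -> 0 < target ->
  has_diversity_order
    (fun p => outage_probability P (snr g h phi G sv2 su2 p) target) M%:R.
Proof.
move=> mg mh mphi ind C1 bh bg co sv su G0 t0.
apply: has_diversity_order_squeeze.
  exact: (outage_lower_bound mg mh mphi ind C1 bh bg).
by move=> e e0; exact: (outage_upper_bound mg mh mphi ind C1 bh bg).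
Qed.

Theorem corollary1 (R : realType) (d : measure_display) (T : measurableType d)
  (P : probability T R) (M : nat) (hM : (1 <= M)%N)
  (K_g Omega_g : R) (K_h Omega_h : user -> R)
  (hKg : 0 <= K_g) (hOg : 0 < Omega_g)
  (hKh : forall c, 0 <= K_h c) (hOh : forall c, 0 < Omega_h c)
  (g : 'I_M -> T -> R[i]) (h : user -> 'I_M -> T -> R[i])
  (hg : forall m, rician P K_g Omega_g (g m))
  (hh : forall c m, rician P (K_h c) (Omega_h c) (h c m))
  (hind : mutually_independent P (fun l => @ReIm R \o channels g h l))
  (sigma_v : R) (sigma : user -> R)
  (hsv : 0 < sigma_v ^+ 2) (hs : forall c, 0 < sigma c ^+ 2)
  (G : user -> R) (hG : forall c, 0 < G c)
  (target : user -> R) (ht : forall c, 0 < target c) :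
  let Pout (phi : user -> 'I_M -> {RV P >-> R}) (c : user) (p : R) :=
    outage_probability P
      (snr g (h c) (fun m => phi c m) (G c) (sigma_v ^+ 2) (sigma c ^+ 2) p)
      (target c) in
  (forall phi : user -> 'I_M -> {RV P >-> R},
     independent_phase_shift g h phi ->
     forall c, has_diversity_order (Pout phi c) M%:R) /\
  (forall phi : user -> 'I_M -> {RV P >-> R},
     coupled_phase_shift g h phi ->
     has_diversity_order (Pout phi UserA) M%:R).
Proof.
have bounds (l : 'I_M + user * 'I_M) :
    exists2 C : R, 0 < C & fading_bounds P (@ReIm R \o channels g h l) C.
  by case: l => [m|[c m]] /=; [exact: rician_fading_bounds (hg m)|
    exact: rician_fading_bounds (hh c m)].
have [C C1 bC] := fading_bounds_uniform bounds.
have main (phi : user -> 'I_M -> {RV P >-> R}) c :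
    cophase g (h c) (fun m => phi c m) -> has_diversity_order (fun p =>
      outage_probability P (snr g (h c) (fun m => phi c m) (G c)
        (sigma_v ^+ 2) (sigma c ^+ 2) p) (target c)) M%:R.
  move=> co; apply: (cophase_diversity (C := C)) => //.
  - by move=> m; have [] := rician_law hKg hOg (hg m).
  - by move=> m; have [] := rician_law (hKh c) (hOh c) (hh c m).
  - exact: independent_links_user.
  - by move=> m; exact: (bC (inr (c, m))).
  - by move=> m; exact: (bC (inl m)).
  - exact: ltW.
by split=> phi; [move=> co c; apply: main; exact: co|case=> co _; exact: main].
Qed.
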